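(* Let $d\geq 2$ be an integer, and let $\mathfrak{S}_{d+1}$ denote the symmetric group on $d+1$ letters. Let $\nu_d\colon \mathrm{A}(\mathbb{R}^d,d+1)\to\mathbb{R}^{d+1}$ be the map sending a $(d+1)$-tuple of affinely independent points in $\mathbb{R}^d$ to the facet volume vector of the simplex they span. Then \[ \operatorname{im}(\nu_d)=\big\{(\alpha_1,\dots,\alpha_{d+1})\in(\mathbb{R}_{>0})^{d+1} \ :\ \alpha_{\pi(d+1)}<\alpha_{\pi(1)}+\dots+ \alpha_{\pi(d)}\ \text{ for all }\pi\in\mathfrak{S}_{d+1}\big\}. \]
   Context: $\mathbb{R}_{>0}=(0,+\infty)$. $\mathrm{A}(\mathbb{R}^d,d+1)\subseteq(\mathbb{R}^d)^{d+1}$ is the set of all tuples $(x_1,\dots,x_{d+1})$ of affinely independent points of $\mathbb{R}^d$, i.e. such that $\sum_{i}\lambda_i x_i\neq 0$ for every nonzero $(\lambda_1,\dots,\lambda_{d+1})\in\mathbb{R}^{d+1}$ with $\sum_i\lambda_i=0$. For such a tuple and $1\leq i\leq d+1$, let $F_i(x_1,\dots,x_{d+1}):=\operatorname{conv}(\{x_1,\dots,x_{d+1}\}\setminus\{x_i\})$ be the facet opposite to $x_i$ of the simplex $\operatorname{conv}\{x_1,\dots,x_{d+1}\}$, and let $v_i(x_1,\dots,x_{d+1}):=\operatorname{vol}_{d-1}(F_i(x_1,\dots,x_{d+1}))$ be its $(d-1)$-dimensional volume. The facet volume vector is $\nu_d(x_1,\dots,x_{d+1}):=(v_1(x_1,\dots,x_{d+1}),\dots,v_{d+1}(x_1,\dots,x_{d+1}))$.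 *)

(* Defs.v *)
From HB Require Import structures.
From mathcomp Require Import all_boot all_order all_algebra all_fingroup.
From mathcomp Require Import all_classical all_reals all_analysis.

Set Implicit Arguments.
Unset Strict Implicit.
Unset Printing Implicit Defensive.

Import Order.TTheory GRing.Theory Num.Theory.
Import numFieldNormedType.Exports.

Local Open Scope classical_set_scope.
Local Open Scope ring_scope.

(* The n-dimensional Lebesgue measure, as the n-fold product of
   [lebesgue_measure], transported along (x, t) |-> x :: t.  The lemmas
   [lebesgue_tuple_measure] and [lebesgue_tuple_box] below confirm that it is a
   sigma-finite measure giving each box the product of its side measures. *)
Fixpoint lebesgue_tuple (R : realType) (n : nat) :
    set (n.-tuple (measurableTypeR R)) -> \bar R :=
  match n with
  | 0 => \d_ [tuple]
  | m.+1 => pushforward (lebesgue_measure \x @lebesgue_tuple R m)%E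
              (fun p => [tuple of p.1 :: p.2])
  end.

Lemma pushforward_product_measure (R : realType) (d1 d2 d3 : measure_display)
    (T1 : measurableType d1) (T2 : measurableType d2) (T3 : measurableType d3)
    (m1 : {sigma_finite_measure set T1 -> \bar R})
    (m2 : {sigma_finite_measure set T2 -> \bar R})
    (f : T1 * T2 -> T3) (g : T3 -> T1 * T2) :
  measurable_fun setT f -> measurable_fun setT g -> cancel f g ->
  exists mu : {sigma_finite_measure set T3 -> \bar R},
    pushforward (m1 \x m2)%E f = mu.
Proof.
move=> mf mg fK.
pose m : {measure set (T1 * T2) -> \bar R} :=
  [the {measure set _ -> \bar R} of (m1 \x m2)%E].
pose nu : {measure set T3 -> \bar R} :=
  measure_function_pushforward__canonical__measure_function_Measure m mf.
have nu_sigma_finite : sigma_finite setT nu.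
  have /sigma_finiteP[F [FT ndF Foo]] := sigma_finiteT m1.
  have /sigma_finiteP[G [GT ndG Goo]] := sigma_finiteT m2.
  exists (fun k => g @^-1` (F k `*` G k)).
    rewrite -preimage_bigcup -(preimage_setT g); congr (_ @^-1` _).
    apply/esym; rewrite -subTset => -[x y] _.
    have [i _ Fx] : (\bigcup_i F i) x by rewrite -FT.
    have [j _ Gy] : (\bigcup_i G i) y by rewrite -GT.
    exists (maxn i j) => //; split.
      by move: x Fx; exact/subsetPset/ndF/leq_maxl.
    by move: y Gy; exact/subsetPset/ndG/leq_maxr.
  move=> k; have [[mF Fk] [mG Gk]] := (Foo k, Goo k); split.
    by rewrite -[X in measurable X]setTI; apply: mg => //; exact: measurableX.
  rewrite /= /pushforward -comp_preimage (_ : g \o f = id); last exact/funext.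
  by rewrite preimage_id product_measure1E// lte_mul_pinfty// ge0_fin_numE.
pose isf := Measure_isSigmaFinite.Build _ _ _ nu nu_sigma_finite.
pose nu' : {sigma_finite_measure set T3 -> \bar R} :=
  HB.pack (Measure.sort nu) isf.
by exists nu'.
Qed.

Lemma lebesgue_tuple_measure (R : realType) (n : nat) :
  exists mu :
      {sigma_finite_measure set (n.-tuple (measurableTypeR R)) -> \bar R},
    @lebesgue_tuple R n = mu.
Proof.
elim: n => [|n [mu muE]].
  by exists (\d_ ([tuple] : 0.-tuple (measurableTypeR R))).
rewrite /= muE.
pose f (p : measurableTypeR R * n.-tuple (measurableTypeR R)) :=
  [tuple of p.1 :: p.2].
pose g (t : n.+1.-tuple (measurableTypeR R)) := (thead t, [tuple of behead t]).
have mf : measurable_fun setT f by exact: measurable_cons.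
have mg : measurable_fun setT g.
  by apply/measurable_fun_pair; [exact: measurable_tnth|exact: measurable_behead].
apply: (pushforward_product_measure
  [the {sigma_finite_measure set _ -> \bar R} of lebesgue_measure] mu mf mg).
by case=> x t; congr pair; apply/val_inj.
Qed.

Lemma lebesgue_tuple_box (R : realType) (n : nat)
    (B : 'I_n -> set (measurableTypeR R)) :
  (forall i, measurable (B i)) ->
  lebesgue_tuple [set t | forall i, B i (tnth t i)] =
  (\prod_(i < n) lebesgue_measure (B i))%E.
Proof.
elim: n B => [|n IH] B mB.
  rewrite /= big_ord0 diracE (_ : _ \in _ = true) //.
  by apply/mem_set => -[].
have [mu muE] := lebesgue_tuple_measure R n.
rewrite big_ord_recl /= /pushforward muE.
pose B' := [set t : n.-tuple (measurableTypeR R) |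
  forall i, B (lift ord0 i) (tnth t i)].
have mB' : measurable B'.
  rewrite (_ : B' = \bigcap_(i in [set: 'I_n])
                     (@tnth n _ ^~ i) @^-1` B (lift ord0 i)).
    apply: fin_bigcap_measurable => [|i _]; first exact: finite_finset.
    by rewrite -[X in measurable X]setTI; exact: measurable_tnth.
  by apply/seteqP; split => [t tB i _|t tB i]; [exact: tB|exact: (tB i)].
rewrite (_ : _ @^-1` _ = B ord0 `*` B').
  rewrite product_measure1E// -muE; congr (_ * _)%E.
  by apply: IH => i; exact: mB.
apply/seteqP; split => -[x t] /=.
  move=> tB; split; first exact: (tB ord0).
  by move=> i; have := tB (lift ord0 i); rewrite tnthS.
case=> Bx Bt i; case: (unliftP ord0 i) => [j|] -> //.
by rewrite tnthS; exact: Bt.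
Qed.

Section simplices.
Context {R : realType}.

(* t |-> p + t Q; when the rows of Q are orthonormal, this is an isometry of
   R^n onto an n-dimensional affine subspace of R^d. *)
Definition flat_chart (n d : nat) (p : 'rV[R]_d) (Q : 'M[R]_(n, d))
    (t : n.-tuple (measurableTypeR R)) : 'rV[R]_d :=
  p + (\row_(j < n) (tnth t j : R)) *m Q.

(* The n-dimensional volume of a subset S of an n-dimensional affine subspace of
   R^d: the Lebesgue measure of S in any isometric coordinates of that subspace.
   For S Borel the value does not depend on the coordinates (p, Q), so that the
   infimum is merely a way to select it. *)
Definition flat_volume (n d : nat) (S : set 'rV[R]_d) : \bar R :=
  ereal_inf [set v | exists (p : 'rV[R]_d) (Q : 'M[R]_(n, d)),
    [/\ Q *m Q^T = 1%:M, S `<=` range (flat_chart p Q) &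
        v = lebesgue_tuple (flat_chart p Q @^-1` S)]].

Definition affinely_independent (n d : nat) (x : 'I_n -> 'rV[R]_d) : Prop :=
  forall l : 'I_n -> R, (exists i, l i != 0) -> \sum_i l i = 0 ->
    \sum_i l i *: x i != 0.

Definition convex_hull (d : nat) (A : set 'rV[R]_d) : set 'rV[R]_d :=
  smallest (@convex_set R 'rV[R]_d) A.

Definition facet (n d : nat) (x : 'I_n -> 'rV[R]_d) (i : 'I_n) : set 'rV[R]_d :=
  convex_hull (range x `\ x i).

Definition facet_volume_vector (d : nat) (x : 'I_d.+1 -> 'rV[R]_d) :
    'rV[R]_d.+1 :=
  \row_(i < d.+1) fine (flat_volume d.-1 (facet x i)).

End simplices.

(* Main.v *)
(* Let g_i be the gradient of the i-th barycentric coordinate of a simplex with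
   vertices x_i, and X the matrix with rows (1, x_i); the g_i are read off the
   columns of X^-1.  The facet opposite to x_i has volume c |det X| |g_i|, where
   c is the volume of the unit simplex in dimension d - 1: this is the linear
   change of variables in a chart of the facet, followed by a Gram determinant
   computation.  The g_i sum to 0 and no two of them are parallel, so the strict
   triangle inequality gives one inclusion.  Conversely, any spanning family of
   d + 1 vectors of R^d with sum 0 is the family of gradients of a simplex, and
   rescaling it rescales all the facet volumes by the same factor.  Such a family
   with prescribed norms is built by induction on d, splitting a side of a closed
   polygon in R^(d-1) into two sides that leave that subspace in opposite
   directions. *)
Require Import Defs.
From mathcomp Require Import all_boot all_order all_algebra all_fingroup.
From mathcomp Require Import all_classical all_reals all_analysis
  measurable_realfun.
From mathcomp Require Import ring lra.

Set Implicit Arguments.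
Unset Strict Implicit.
Unset Printing Implicit Defensive.

Import Order.TTheory GRing.Theory Num.Theory.
Local Open Scope classical_set_scope.
Local Open Scope ring_scope.

(** * Affine change of variables *)

(** The left side is a measure in [S], so uniqueness of Lebesgue measure reduces the claim to
    intervals []u, v]]. For negative [a] the preimage is closed on the other side, with the same
    length. *)
Lemma lebesgue_measure_affine {R : realType} (a b : R)
    (S : set (measurableTypeR R)) : a != 0 -> measurable S ->
  (`|a|%:E * lebesgue_measure ((fun x : R => (a * x + b)%R) @^-1` S) =
   lebesgue_measure S)%E.
Proof.
move=> a0 mS.
pose f (x : measurableTypeR R) : measurableTypeR R := (a * x + b)%R.
have mf : measurable_fun setT f by apply: measurable_funD => //;
  exact: measurable_funM.
pose nu : {measure set (measurableTypeR R) -> \bar R} :=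
  mscale (NngNum (normr_ge0 a))
  (measure_function_pushforward__canonical__measure_function_Measure
    lebesgue_measure mf).
rewrite -[LHS]/(nu S); apply/esym; move: S mS;
  apply: lebesgue_measure_unique => _ [[u v] _ <-].
rewrite /nu /= /mscale /= /pushforward /=.
have [a_gt0|a_le0] := ltP 0 a.
  have -> : f @^-1` [set` `]u, v]] = [set` `](u - b) / a, (v - b) / a]].
    apply/seteqP; split => x;
      rewrite /f /= !in_itv /= ltr_pdivrMr ?ler_pdivlMr // ltrBlDr lerBrDr
      mulrC //.
  rewrite !lebesgue_measure_itv /= !lte_fin ltr_pM2r ?invr_gt0 // ltrD2r.
  case: ifP => _; last by rewrite mule0.
  by rewrite -!EFinD -EFinM; congr (_%:E); rewrite gtr0_norm //; field.
have a_lt0 : (a < 0)%R by rewrite lt_neqAle a0.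
have -> : f @^-1` [set` `]u, v]] = [set` `[(v - b) / a, (u - b) / a[].
  by apply/seteqP; split => x;
    rewrite /f /= !in_itv /= ltr_ndivlMr ?ler_ndivrMr // ltrBlDr lerBrDr mulrC
    andbC.
rewrite !lebesgue_measure_itv /= !lte_fin ltr_nM2r ?invr_lt0 // ltrD2r.
case: ifP => _; last by rewrite mule0.
by rewrite -!EFinD -EFinM; congr (_%:E); rewrite ltr0_norm //; field.
Qed.

Section product_fiberwise.
Context d1 d2 (T1 : measurableType d1) (T2 : measurableType d2) (R : realType).
Variables (m1 : {sigma_finite_measure set T1 -> \bar R})
  (m2 : {sigma_finite_measure set T2 -> \bar R}) (k : R).
Hypothesis k_ge0 : 0 <= k.

(** The map moves only the second component, so the factor [k] found on every fibre passes through
    the integral over the first. *)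
Lemma product_measure_fiberwise2 (psi : T1 -> T2 -> T2) :
  measurable_fun setT (fun p : T1 * T2 => (p.1, psi p.1 p.2)) ->
  (forall x S, measurable S -> k%:E * m2 (psi x @^-1` S) = m2 S)%E ->
  forall S, measurable S ->
  (k%:E * (m1 \x m2) ((fun p => (p.1, psi p.1 p.2)) @^-1` S) = (m1 \x m2) S)%E.
Proof.
move=> mpsi psiE S mS.
have mS' : measurable ((fun p : T1 * T2 => (p.1, psi p.1 p.2)) @^-1` S).
  by rewrite -[X in measurable X]setTI; exact: mpsi.
rewrite /product_measure1 -ge0_integralZl//;
  last exact: measurable_fun_xsection.
apply: eq_integral => x _ /=; rewrite -(psiE x (xsection S x));
  last exact: measurable_xsection.
congr (_ * m2 _)%E; apply/seteqP; split => y;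
  rewrite /xsection /preimage /= !inE //.
Qed.

(** Same argument with the integrations exchanged: both iterated integrals agree on rectangles,
    hence as measures. *)
Lemma product_measure_fiberwise1 (psi : T2 -> T1 -> T1) :
  measurable_fun setT (fun p : T1 * T2 => (psi p.2 p.1, p.2)) ->
  (forall y S, measurable S -> k%:E * m1 (psi y @^-1` S) = m1 S)%E ->
  forall S, measurable S ->
  (k%:E * (m1 \x m2) ((fun p => (psi p.2 p.1, p.2)) @^-1` S) = (m1 \x m2) S)%E.
Proof.
move=> mpsi psiE S mS.
have mS' : measurable ((fun p : T1 * T2 => (psi p.2 p.1, p.2)) @^-1` S).
  by rewrite -[X in measurable X]setTI; exact: mpsi.
have E A : measurable A -> (m1 \x m2)%E A = (m1 \x^ m2)%E A.
  move=> mA; rewrite -[RHS]/([the measure _ _ of (m1 \x^ m2)%E] A).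
  apply: product_measure_unique => // B C mB mC.
  exact: product_measure2E.
rewrite !E // /product_measure2 -ge0_integralZl//;
  last exact: measurable_fun_ysection.
apply: eq_integral => x _ /=; rewrite -(psiE x (ysection S x));
  last exact: measurable_ysection.
congr (_ * m1 _)%E; apply/seteqP; split => y;
  rewrite /ysection /preimage /= !inE //.
Qed.

End product_fiberwise.

Section affine_change_of_variables.
Context {R : realType}.
Local Notation tup n := (n.-tuple (measurableTypeR R)).

Definition row_of_tuple {n} (t : tup n) : 'rV[R]_n := \row_j (tnth t j : R).

Definition tuple_of_row {n} (v : 'rV[R]_n) : tup n :=
  [tuple (v 0 j : measurableTypeR R) | j < n].

Definition affine_map {n} (A : 'M[R]_n) (b : 'rV[R]_n) (t : tup n) : tup n :=
  tuple_of_row (row_of_tuple t *m A + b).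

Lemma tuple_of_rowK n : cancel (@tuple_of_row n) row_of_tuple.
Proof. by move=> v; apply/rowP => j; rewrite mxE tnth_mktuple. Qed.

Lemma row_of_tupleK n : cancel (@row_of_tuple n) tuple_of_row.
Proof. by move=> t; apply/eq_from_tnth => j; rewrite tnth_mktuple mxE. Qed.

Lemma row_of_tuple_cons n (x : R) (t : tup n) :
  row_of_tuple [tuple of (x : measurableTypeR R) :: t] =
  row_mx x%:M (row_of_tuple t) :> 'rV_(1 + n).
Proof.
apply/rowP => j; case: (splitP j) => k jk.
  have -> : j = lshift n k by exact/val_inj.
  by rewrite row_mxEl !mxE ord1 eqxx.
have -> : j = rshift 1 k by exact/val_inj.
rewrite row_mxEr !mxE.
have -> : rshift 1 k = lift ord0 k by exact/val_inj.
by rewrite tnthS.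
Qed.

(** The translation may vary with the parameter, as it does for the second factor in the pivot step
    below. *)
Lemma measurable_affine_map d (T : measurableType d) n (A : 'M[R]_n)
    (v : T -> 'rV[R]_n) (f : T -> tup n) :
  measurable_fun setT f ->
  (forall i, measurable_fun setT (fun t => v t 0 i)) ->
  measurable_fun setT (fun t => affine_map A (v t) (f t)).
Proof.
move=> mf mv; apply/measurable_fun_tnthP => i.
rewrite (_ : _ \o _ =
  (fun t => (\sum_j (tnth (f t) j : R) * A j i)%R) \+ (fun t => v t 0 i)).
  apply: measurable_funD => //; apply: measurable_sum => j.
  apply: measurable_funM => //.
  by apply: (@measurableT_comp _ _ _ _ _ _ (fun t : tup n => tnth t j)) => //;
    exact: measurable_tnth.
apply/funext => t /=; rewrite tnth_mktuple !mxE; congr (_ + _)%R.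
by apply: eq_bigr => j _; rewrite mxE.
Qed.

Lemma affine_map_comp n (A B : 'M[R]_n) (a b : 'rV[R]_n) :
  affine_map A a \o affine_map B b = affine_map (B *m A) (b *m A + a).
Proof.
apply/funext => t; rewrite /affine_map /= tuple_of_rowK; congr tuple_of_row.
by rewrite mulmxDl mulmxA addrA.
Qed.

(** All translations [b] are covered at once, because in the induction on [n] the translation
    changes from fibre to fibre. *)
Let scales n (A : 'M[R]_n) := forall b (S : set (tup n)), measurable S ->
  (`|\det A|%:E * lebesgue_tuple (affine_map A b @^-1` S) =
   lebesgue_tuple S)%E.

Let measurable_affine_preimage n (A : 'M[R]_n) b (S : set (tup n)) :
  measurable S -> measurable (affine_map A b @^-1` S).
Proof.
move=> mS; rewrite -[X in measurable X]setTI.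
exact: (@measurable_affine_map _ (tup n) n A (cst b) id).
Qed.

Let scalesM n (A B : 'M[R]_n) : scales A -> scales B -> scales (B *m A).
Proof.
move=> sA sB b S mS; rewrite det_mulmx normrM EFinM -muleA.
have -> : affine_map (B *m A) b = affine_map A b \o affine_map B 0.
  by rewrite affine_map_comp mul0mx add0r.
rewrite comp_preimage muleCA (sB 0) ?sA //.
exact: measurable_affine_preimage.
Qed.

(* With pivot [a], write (x, y) A = (X, X a^-1 b + y D), where X = x a + y c and
   D is the Schur complement: two maps that move one component each. *)
Let scales_pivot n (A : 'M[R]_(1 + n)) :
  (forall B : 'M[R]_n, B \in unitmx -> scales B) ->
  ulsubmx A 0 0 != 0 -> A \in unitmx -> @scales n.+1 A.
Proof.
move=> IH; set a := ulsubmx A 0 0 => a0 uA b S mS.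
pose D := drsubmx A - a^-1 *: (dlsubmx A *m ursubmx A).
have ulE : ulsubmx A = a%:M by rewrite [LHS]mx11_scalar.
have detA : \det A = a * \det D.
  have {1}-> : A = block_mx 1%:M 0 (a^-1 *: dlsubmx A) 1%:M *m
                   block_mx a%:M (ursubmx A) 0 D.
    rewrite mulmx_block !mul1mx !mul0mx !addr0 -ulE.
    rewrite -[LHS]submxK; congr block_mx; rewrite ?mulmx0 ?addr0.
      by rewrite ulE mul_mx_scalar scalerA divff // scale1r.
    by rewrite -scalemxAl addrC subrK.
  by rewrite det_mulmx det_lblock det_ublock !det1 !mul1r det_scalar1.
have uD : D \in unitmx.
  by move: uA; rewrite !unitmxE detA unitrM => /andP[].
have [mu muE] := lebesgue_tuple_measure R n.
pose phi1 (p : measurableTypeR R * tup n) : measurableTypeR R * tup n :=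
  ((a * p.1 + ((row_of_tuple p.2 *m dlsubmx A) 0 0 + b 0 ord0))%R, p.2).
(* Here [x] is the first coordinate already produced by [phi1]; subtracting [b 0 ord0] leaves the
   linear part X. *)
pose off (x : R) : 'rV[R]_n :=
  (x - b 0 ord0) *: (a^-1 *: ursubmx A) + rsubmx (b : 'rV_(1 + n)).
pose phi2 (p : measurableTypeR R * tup n) : measurableTypeR R * tup n :=
  (p.1, affine_map D (off p.1) p.2).
pose c (p : measurableTypeR R * tup n) : tup n.+1 := [tuple of p.1 :: p.2].
have mc : measurable_fun setT c by exact: measurable_cons.
have m1 : measurable_fun setT phi1.
  apply/measurable_fun_pair => //=; apply: measurable_funD.
    by apply: measurable_funM => //; exact: measurable_fst.
  apply: measurable_funD => //.
  rewrite (_ : (fun x => _) = (fun p : measurableTypeR R * tup n =>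
    (\sum_j (tnth p.2 j : R) * dlsubmx A j 0)%R)).
    apply: measurable_sum => j; apply: measurable_funM => //.
    apply: (@measurableT_comp _ _ _ _ _ _ (fun t : tup n => tnth t j)) => //.
    exact: measurable_tnth.
  by apply/funext => p; rewrite !mxE; apply: eq_bigr => j _; rewrite mxE.
have m2 : measurable_fun setT phi2.
  apply/measurable_fun_pair => //=; apply: measurable_affine_map => // i.
  rewrite (_ : (fun x => _) = (fun p : measurableTypeR R * tup n =>
    (((p.1 : R) - b 0 ord0) * (a^-1 *: ursubmx A) 0 i +
       rsubmx (b : 'rV_(1 + n)) 0 i)%R)).
    by apply: measurable_funD => //; apply: measurable_funM => //;
      exact: measurable_funB.
  by apply/funext => p; rewrite /off 2![in LHS]mxE.
have fact : affine_map A b \o c = c \o (phi2 \o phi1).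
  apply/funext => -[x y] /=; apply: (can_inj (@row_of_tupleK _)).
  rewrite tuple_of_rowK [LHS](_ : _ = row_mx x%:M (row_of_tuple y) *m A + b);
    last by rewrite -row_of_tuple_cons.
  rewrite /c /= [RHS]row_of_tuple_cons /affine_map /= tuple_of_rowK.
  rewrite -{1}[A]submxK mul_row_block -{1}[b](@hsubmxK _ 1 1 n) [in
    LHS]add_row_mx.
  congr row_mx.
    apply/rowP => j; rewrite !ord1 ulE -scalar_mxM !mxE eqxx !mulr1n mulrC
      -addrA.
    by congr (_ + (_ + b 0 _)); exact/val_inj.
  rewrite /off [_ - b 0 ord0](_ : _ = a * x + (row_of_tuple y *m dlsubmx A) 0
    0); last by ring.
  rewrite scalerDl scalerA mulrAC divff // mul1r.
  rewrite mul_scalar_mx mulmxBr -scalemxAr mulmxA.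
  rewrite [row_of_tuple y *m dlsubmx A]mx11_scalar mul_scalar_mx.
  rewrite [_%:M 0 0]mxE eqxx mulr1n !scalerA [_ * a^-1]mulrC.
  set u := _ *m drsubmx A; set v := x *: _; set w := (a^-1 * _) *: _.
  by rewrite [v + w]addrC -[w + v + _]addrA [RHS]addrA subrK addrA [u + v]addrC.
have mS' : measurable (c @^-1` S) by rewrite -[X in measurable X]setTI;
  exact: mc.
have mS'' : measurable (phi2 @^-1` (c @^-1` S)).
  by rewrite -[X in measurable X]setTI; exact: m2.
(* The factor [phi1] contributes |a| by the one-dimensional case, and [phi2] contributes |det D| by
   induction. *)
rewrite detA normrM /= /pushforward muE -/c -comp_preimage fact !comp_preimage.
rewrite mulrC EFinM -muleA.
rewrite (_ : (`|a|%:E * _)%E = (lebesgue_measure \x mu)%E (phi2 @^-1` (c @^-1`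
  S))).
  apply: (@product_measure_fiberwise2 _ _ _ _ _ lebesgue_measure mu _
    (normr_ge0 (\det D))
    (fun x => affine_map D (off x))) => // x T mT.
  by rewrite -muE; exact: IH.
apply: (@product_measure_fiberwise1 _ _ _ _ _ lebesgue_measure mu _ (normr_ge0
  a)
  (fun y x => (a * x + ((row_of_tuple y *m dlsubmx A) 0 0 + b 0 ord0))%R)) =>
    // y T mT.
exact: lebesgue_measure_affine.
Qed.

(** Induction on [n]. With a nonzero corner entry [scales_pivot] applies; otherwise [A] is a product
    of two invertible matrices with nonzero corner entries. *)
Lemma lebesgue_tuple_affine n (A : 'M[R]_n) (b : 'rV[R]_n) (S : set (tup n)) :
  A \in unitmx -> measurable S ->
  (`|\det A|%:E * lebesgue_tuple (affine_map A b @^-1` S) =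
   lebesgue_tuple S)%E.
Proof.
move=> uA mS; suff: scales A by exact.
elim: n A {b S mS} uA => [|n IH] A uA.
  move=> b S _; rewrite det_mx00 normr1 mul1e; congr lebesgue_tuple.
  by apply/seteqP; split => t;
    rewrite /= (tuple0 (affine_map _ _ _)) (tuple0 t).
have [a0|] := eqVneq (ulsubmx (A : 'M[R]_(1 + n)) 0 0) 0; last by move=> a0;
  exact: scales_pivot.
(* Adding to the first row the combination [e] of the others turns the zero
   pivot into the squared norm of the first column. *)
pose e : 'rV[R]_n := (dlsubmx (A : 'M[R]_(1 + n)))^T.
pose P (e : 'rV[R]_n) : 'M[R]_(1 + n) := block_mx 1%:M e 0 1%:M.
have PK : P (- e) *m P e = 1%:M.
  rewrite mulmx_block !mul1mx !mulmx1 !mul0mx !mulmx0 !addr0 !add0r subrr.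
  by rewrite -scalar_mx_block.
have uP f : P f \in unitmx by rewrite unitmxE det_ublock !det1 mulr1 unitr1.
have -> : A = P (- e) *m (P e *m (A : 'M[R]_(1 + n))) by rewrite mulmxA PK
  mul1mx.
apply: (@scalesM n.+1); apply: scales_pivot => //; first last.
- by rewrite /P block_mxKul mxE oner_neq0.
- by rewrite unitmx_mul uP.
rewrite -[A](@submxK _ 1 n 1 n) mulmx_block block_mxKul mul1mx mxE a0 add0r.
apply/negP => /eqP e0.
(* A new pivot equal to zero would make the whole first column vanish, contradicting
   invertibility. *)
have c0 : dlsubmx (A : 'M[R]_(1 + n)) = 0.
  apply/matrixP => i j; rewrite ord1 !mxE; apply/eqP; rewrite -sqrf_eq0.
  move: e0; rewrite mxE => /eqP; rewrite psumr_eq0; last first.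
    by move=> k _; rewrite !mxE -expr2 sqr_ge0.
  by move=> /allP /(_ i); rewrite mem_index_enum !mxE -expr2; exact.
move: uA; rewrite unitmxE (_ : \det A = 0) ?unitr0 //.
rewrite -[A](@submxK _ 1 n 1 n) c0 [LHS](@det_ublock _ 1 n).
by rewrite [ulsubmx _]mx11_scalar a0 det_scalar1 mul0r.
Qed.

End affine_change_of_variables.

(** * Volumes of simplices *)

Section dot_product.
Context {R : realDomainType} {d : nat}.
Implicit Types u v w : 'rV[R]_d.

Definition dot u v : R := (u *m v^T) 0 0.

Lemma dotE u v : dot u v = \sum_j u 0 j * v 0 j.
Proof. by rewrite /dot mxE; apply: eq_bigr => j _; rewrite [v^T _ _]mxE. Qed.

Lemma dotC u v : dot u v = dot v u.
Proof. by rewrite !dotE; apply: eq_bigr => j _; rewrite mulrC. Qed.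

Lemma dotDl u v w : dot (u + v) w = dot u w + dot v w.
Proof. by rewrite /dot mulmxDl mxE. Qed.

Lemma dotDr u v w : dot w (u + v) = dot w u + dot w v.
Proof. by rewrite ![dot w _]dotC dotDl. Qed.

Lemma dotNl u v : dot (- u) v = - dot u v.
Proof. by rewrite /dot mulNmx mxE. Qed.

Lemma dotBr u v w : dot w (u - v) = dot w u - dot w v.
Proof. by rewrite dotDr ![dot w _]dotC dotNl. Qed.

Lemma dotZl a u v : dot (a *: u) v = a * dot u v.
Proof. by rewrite /dot -scalemxAl mxE. Qed.

Lemma dotZr a u v : dot u (a *: v) = a * dot u v.
Proof. by rewrite dotC dotZl dotC. Qed.

Lemma dot_suml (I : Type) (r : seq I) (P : pred I) (F : I -> 'rV_d) v :
  dot (\sum_(i <- r | P i) F i) v = \sum_(i <- r | P i) dot (F i) v.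
Proof. by rewrite /dot mulmx_suml summxE. Qed.

Lemma dotrr_ge0 u : 0 <= dot u u.
Proof. by rewrite dotE sumr_ge0 // => j _; rewrite -expr2 sqr_ge0. Qed.

Lemma dotrr_eq0 u : (dot u u == 0) = (u == 0).
Proof.
apply/eqP/eqP => [|->]; last by rewrite /dot mul0mx mxE.
rewrite dotE => /eqP; rewrite psumr_eq0 => [|j _];
  last by rewrite -expr2 sqr_ge0.
move=> /allP u0; apply/rowP => j; apply/eqP.
by have := u0 j (mem_index_enum _);
  rewrite -expr2 sqrf_eq0 [X in _ -> _ == X]mxE.
Qed.

Lemma dotrr_gt0 u : (0 < dot u u) = (u != 0).
Proof. by rewrite lt0r dotrr_eq0 dotrr_ge0 andbT. Qed.

End dot_product.

Section unit_simplex.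
Context {R : realType}.
Local Notation tup n := (n.-tuple (measurableTypeR R)).

Definition unit_simplex n : set (tup n) :=
  [set t | (forall i, 0 <= (tnth t i : R)) /\ \sum_i (tnth t i : R) <= 1].

Lemma measurable_box n (B : 'I_n -> set (measurableTypeR R)) :
  (forall i, measurable (B i)) ->
  measurable [set t : tup n | forall i, B i (tnth t i)].
Proof.
move=> mB.
rewrite (_ : mkset _ = \bigcap_(i in [set: 'I_n]) (@tnth n _ ^~ i) @^-1` B i).
  apply: fin_bigcap_measurable => [|i _]; first exact: finite_finset.
  by rewrite -[X in measurable X]setTI; exact: measurable_tnth.
by apply/seteqP; split => t tB i; [move=> _; exact: tB|exact: tB].
Qed.

Lemma measurable_unit_simplex n : measurable (@unit_simplex n).
Proof.
rewrite (_ : @unit_simplex n = [set t | forall i, [set` `[0, +oo[] (tnth t i :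
  R)] `&`
    (fun t => \sum_i (tnth t i : R)) @^-1` [set` `]-oo, 1]]).
  apply: measurableI; first exact: (@measurable_box n (fun=> [set` `[0, +oo[])).
  rewrite -[X in measurable X]setTI.
  apply: (@measurable_sum _ (tup n) R) => // i; exact: measurable_tnth.
apply/seteqP; split => t /=; rewrite in_itv /=.
  by case=> t0 t1; split => // i; rewrite in_itv /= andbT.
by case=> t0 t1; split => // i; have := t0 i; rewrite in_itv /= andbT.
Qed.

Lemma lebesgue_tuple_cube n (c : R) : 0 <= c ->
  lebesgue_tuple [set t : tup n | forall i, [set` `[0, c]] (tnth t i : R)] =
  (c ^+ n)%:E.
Proof.
move=> c0; rewrite (lebesgue_tuple_box (B := fun=> [set` `[0, c]])) //.
rewrite (eq_bigr (fun=> c%:E)) => [|i _].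
  by rewrite prodEFin prodr_const card_ord.
rewrite lebesgue_measure_itv /= lte_fin.
case: ltP => c0'; first by rewrite oppr0 adde0.
by congr (_%:E); apply/le_anti; rewrite c0.
Qed.

(** Finite because the simplex lies in the unit cube, positive because it contains the cube of side
    1/(n+1). *)
Lemma unit_simplex_volume n :
  exists2 c : R, 0 < c & lebesgue_tuple (@unit_simplex n) = c%:E.
Proof.
have [mu muE] := lebesgue_tuple_measure R n.
have mS := @measurable_unit_simplex n.
have n0 : 0 <= (n.+1%:R : R)^-1 by rewrite invr_ge0.
have le_oo : (lebesgue_tuple (@unit_simplex n) <= 1%:E)%E.
  rewrite -(expr1n _ n) -lebesgue_tuple_cube // muE; apply: le_measure.
  - by rewrite inE.
  - by rewrite inE; exact: (@measurable_box n (fun=> [set` `[0, _]])).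
  - move=> t [t0 t1] i /=; rewrite in_itv /= t0 /=; apply: le_trans t1.
    by rewrite (bigD1 i) //= lerDl sumr_ge0.
have gt_0 : ((n.+1%:R^-1 ^+ n)%:E <= lebesgue_tuple (@unit_simplex n))%E.
  rewrite -lebesgue_tuple_cube // muE; apply: le_measure.
  - by rewrite inE; exact: (@measurable_box n (fun=> [set` `[0, _]])).
  - by rewrite inE.
  - move=> t /= tn; split=> [i|].
      by have := tn i; rewrite /= in_itv /= => /andP[].
    apply: (@le_trans _ _ (\sum_(i < n) n.+1%:R^-1)).
      by apply: ler_sum => i _; have := tn i; rewrite /= in_itv /= => /andP[].
    rewrite sumr_const card_ord -[X in X <= _]mulr_natl ler_pdivrMr // mul1r.
    by rewrite ler_nat.
move: le_oo gt_0; case: (lebesgue_tuple _) => // c _; rewrite lee_fin => c0.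
by exists c => //; apply: lt_le_trans c0; rewrite exprn_gt0 // invr_gt0.
Qed.

End unit_simplex.

Section flat_simplices.
Context {R : realType}.
Local Notation tup n := (n.-tuple (measurableTypeR R)).

(** Gram-Schmidt by induction: orthonormalise the last [n] rows, then subtract from the first row
    its projection on them and normalise the rest. *)
Lemma row_free_gram_schmidt n d (E : 'M[R]_(n, d)) : row_free E ->
  exists (Q : 'M[R]_(n, d)) (W : 'M[R]_n), Q *m Q^T = 1%:M /\ E = W *m Q.
Proof.
elim: n E => [|n IH] E fE.
  by exists 0, 0; split; apply/matrixP => -[].
pose e : 'rV[R]_d := usubmx (E : 'M[R]_(1 + n, d)).
pose E' : 'M[R]_(n, d) := dsubmx (E : 'M[R]_(1 + n, d)).
have EE : E = col_mx e E' by rewrite vsubmxK.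
have free l (l' : 'rV_n) : l *: e + l' *m E' = 0 -> l = 0 /\ l' = 0.
  rewrite -mul_scalar_mx -mul_row_col -EE => /eqP.
  rewrite (mulmx_free_eq0 _ fE) -(@row_mx0 _ 1 1 n) => /eqP rE.
  by have [/matrixP/(_ 0 0) + ->] := @eq_row_mx R 1 1 n _ _ _ _ rE;
    rewrite !mxE mulr1n => ->.
have fE' : row_free E'.
  apply: inj_row_free => l lE; apply: (free 0 l _).2.
  by rewrite scale0r add0r.
have [Q' [W' [QQ EW]]] := IH _ fE'.
have uW : W' \in unitmx.
  rewrite -row_free_unit; apply: inj_row_free => l lW; apply: (free 0 l _).2.
  by rewrite EW mulmxA lW mul0mx scale0r addr0.
pose r := e - e *m Q'^T *m Q'.
have rQ : r *m Q'^T = 0 by rewrite mulmxBl -(mulmxA _ Q') QQ mulmx1 subrr.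
have Qr : Q' *m r^T = 0 by rewrite -[Q' *m _]trmxK trmx_mul trmxK rQ trmx0.
have r0 : r != 0.
  (* If [r] vanished, [e] would be a combination of the rows of [E']. *)
  apply/eqP => /eqP; rewrite subr_eq0 => /eqP re.
  have [] := free 1 (- (e *m Q'^T *m invmx W')); last by move/eqP;
    rewrite oner_eq0.
  by rewrite scale1r EW mulNmx mulmxA mulmxKV // {1}re subrr.
pose s := dot r r.
have s0 : 0 < s by rewrite dotrr_gt0.
pose a := Num.sqrt s.
have a0 : a != 0 by rewrite sqrtr_eq0 -ltNge.
have aa : a * a = s by rewrite -expr2 sqr_sqrtr // ltW.
exists (col_mx (a^-1 *: r) Q'), (block_mx a%:M (e *m Q'^T) 0 W'); split.
  rewrite (@tr_col_mx R 1 n d) (@mul_col_row R 1 n d 1 n) QQ [(_ *: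
    r)^T]linearZ /=.
  rewrite -!scalemxAl -!scalemxAr rQ Qr !scaler0.
  rewrite [r *m r^T]mx11_scalar -/(dot r r) -/s -aa scalerA scale_scalar_mx.
  rewrite (_ : _ * (a * a) = 1); last by field.
  by rewrite -scalar_mx_block.
rewrite [RHS](@mul_block_col R 1 n 1 n d) mul0mx add0r -EW mul_scalar_mx
  scalerA divff // scale1r.
by rewrite subrK.
Qed.

Lemma convex_setP d (A : set 'rV[R]_d) :
  @convex_set R 'rV[R]_d A <->
  forall x y k, 0 <= k -> k <= 1 -> A x -> A y -> A (k *: x + (1 - k) *: y).
Proof.
split=> cA x y k.
  move=> k0 k1 Ax Ay.
  pose K := Itv01 k0 k1.
  have := cA x y K; rewrite !inE; exact.
rewrite !inE => Ax Ay; apply: cA => //.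
Qed.

(** Induction on the number of points: split off the first weight and divide the others by their sum
    [s], unless [s] is zero. *)
Lemma convex_set_sum d (A : set 'rV[R]_d) : @convex_set R 'rV[R]_d A ->
  forall n (y : 'I_n -> 'rV[R]_d) (l : 'I_n -> R),
  (forall i, 0 <= l i) -> \sum_i l i = 1 -> (forall i, A (y i)) ->
  A (\sum_i l i *: y i).
Proof.
move=> /convex_setP cA; elim=> [|n IH] y l l0 l1 Ay.
  by move/eqP: l1; rewrite big_ord0 eq_sym oner_eq0.
move: l1; rewrite !big_ord_recl => l1.
set s := \sum_(i < n) _ in l1.
have s0 : 0 <= s by exact: sumr_ge0.
have [s00|sn0] := eqVneq s 0.
  rewrite s00 addr0 in l1; rewrite l1 scale1r big1 ?addr0 // => i _.
  have /eqP := s00; rewrite psumr_eq0 // => /allP /(_ i (mem_index_enum _)).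
  by move=> /eqP ->; rewrite scale0r.
have sE : s = 1 - l ord0 by rewrite -l1 addrC addKr.
have -> : \sum_(i < n) l (lift ord0 i) *: y (lift ord0 i) =
    (1 - l ord0) *: \sum_i (l (lift ord0 i) / s) *: y (lift ord0 i).
  rewrite scaler_sumr; apply: eq_bigr => i _.
  by rewrite scalerA -sE mulrC divfK.
apply: cA => //; first by rewrite -l1 lerDl.
apply: IH => [i||i]; rewrite ?divr_ge0 //.
by rewrite -mulr_suml divff.
Qed.

Lemma convex_hull_rangeE d n (y : 'I_n -> 'rV[R]_d) :
  convex_hull (range y) =
  [set v | exists l : 'I_n -> R, [/\ forall i, 0 <= l i, \sum_i l i = 1 &
             v = \sum_i l i *: y i]].
Proof.
apply/seteqP; split.
  apply: smallest_sub.
    apply/convex_setP => _ _ k k0 k1 [l [l0 l1 ->]] [m [m0 m1 ->]].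
    exists (fun i => k * l i + (1 - k) * m i); split=> [i||].
    - by rewrite addr_ge0 // mulr_ge0 // subr_ge0.
    - by rewrite big_split /= -!mulr_sumr l1 m1; ring.
    - rewrite !scaler_sumr -big_split; apply: eq_bigr => i _ /=.
      by rewrite [RHS]scalerDl !scalerA.
  move=> _ [i _ <-]; exists (fun j => (j == i)%:R); split.
  - by move=> j; rewrite ler0n.
  - by rewrite (bigD1 i) //= eqxx big1 ?addr0 // => j /negbTE ->.
  - rewrite (bigD1 i) //= eqxx scale1r big1 ?addr0 // => j /negbTE ->.
    by rewrite scale0r.
move=> _ [l [l0 l1 ->]] A [cA yA]; apply: convex_set_sum => // i.
by apply: yA; exists i.
Qed.

Definition edge_matrix n d (y : 'I_n.+1 -> 'rV[R]_d) : 'M[R]_(n, d) :=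
  \matrix_(j < n) (y (lift ord0 j) - y ord0).

(** The weight of [y ord0] is one minus the others, so barycentric weights correspond to points of
    the unit simplex. *)
Lemma convex_hull_range_image d n (y : 'I_n.+1 -> 'rV[R]_d) :
  convex_hull (range y) =
  (fun t => y ord0 + row_of_tuple t *m edge_matrix y) @` @unit_simplex R n.
Proof.
rewrite convex_hull_rangeE.
have mE (t : tup n) (f : 'I_n -> R) : (forall j, tnth t j = f j) ->
    row_of_tuple t *m edge_matrix y =
    \sum_j f j *: y (lift ord0 j) - (\sum_j f j) *: y ord0.
  move=> tf; rewrite mulmx_sum_row scaler_suml -sumrB; apply: eq_bigr => j _.
  by rewrite rowK mxE tf scalerBr.
apply/seteqP; split.
  move=> _ [l [l0 l1 ->]].
  exists [tuple (l (lift ord0 j) : measurableTypeR R) | j < n].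
    split=> [i|]; first by rewrite tnth_mktuple.
    under eq_bigr do rewrite tnth_mktuple.
    by rewrite -l1 big_ord_recl lerDr.
  rewrite (mE _ (l \o lift ord0)) => [|j]; last by rewrite tnth_mktuple.
  rewrite [in RHS]big_ord_recl /=.
  have -> : \sum_i l (lift ord0 i) = 1 - l ord0.
    by rewrite -l1 big_ord_recl addrC addKr.
  by rewrite scalerBl scale1r opprB [LHS]addrCA [y ord0 + _]addrC subrK addrC.
move=> _ [t [t0 t1] <-].
pose s := \sum_i (tnth t i : R).
pose l i : R := if unlift ord0 i is Some j then (tnth t j : R) else 1 - s.
have l0 : l ord0 = 1 - s by rewrite /l unlift_none.
have lS j : l (lift ord0 j) = tnth t j by rewrite /l liftK.
exists l; split=> [i||].
- by rewrite /l; case: unliftP => // _; rewrite subr_ge0.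
- by rewrite big_ord_recl; under eq_bigr do rewrite lS; rewrite l0 subrK.
- rewrite big_ord_recl; under [in RHS]eq_bigr do rewrite lS; rewrite l0.
  rewrite (mE _ (fun j => tnth t j)) //.
  by rewrite scalerBl scale1r addrA addrAC.
Qed.

(** All admissible charts give the same value and Gram-Schmidt provides one, so the infimum runs
    over a singleton. In a chart the simplex is an affine image of the unit simplex with linear part
    [W], where E = W Q; since Q Q^T = 1, the Gram determinant of E is (det W)^2. *)
Lemma flat_volume_convex_hull d n (y : 'I_n.+1 -> 'rV[R]_d) :
  row_free (edge_matrix y) ->
  flat_volume n (convex_hull (range y)) =
  ((Num.sqrt (\det (edge_matrix y *m (edge_matrix y)^T)))%:E *
    lebesgue_tuple (@unit_simplex R n))%E.
Proof.
set E := edge_matrix y => fE; set S := convex_hull _.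
set V := (X in _ = X).
suff volE (p : 'rV[R]_d) (Q : 'M[R]_(n, d)) : Q *m Q^T = 1%:M ->
    S `<=` range (flat_chart p Q) -> lebesgue_tuple (flat_chart p Q @^-1` S) =
      V.
  have [Q [W [QQ EW]]] := row_free_gram_schmidt fE.
  have SQ : S `<=` range (flat_chart (y ord0) Q).
    rewrite /S convex_hull_range_image => _ [t _ <-].
    exists (tuple_of_row (row_of_tuple t *m W)) => //.
    by rewrite /flat_chart -/(row_of_tuple _) tuple_of_rowK -mulmxA -EW.
  rewrite /flat_volume (_ : mkset _ = [set V]) ?ereal_inf1 //.
  apply/seteqP; split=> [_ [p [Q' [QQ' SQ' ->]]]|_ ->]; first exact: volE.
  by exists (y ord0), Q; split=> //; rewrite volE.
move=> QQ SQ.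
have yS i : S (y i) by move=> A [_]; apply; exists i.
have chartE u : flat_chart p Q u = p + row_of_tuple u *m Q by [].
have [u0 _ u0E] := SQ _ (yS ord0).
have /choice[u uE] (j : 'I_n) : exists u, flat_chart p Q u = y (lift ord0 j).
  by have [u _ <-] := SQ _ (yS (lift ord0 j)); exists u.
pose W : 'M[R]_n := \matrix_(j < n) (row_of_tuple (u j) - row_of_tuple u0).
have EW : E = W *m Q.
  apply/row_matrixP => j; rewrite row_mul !rowK -u0E -uE !chartE.
  by rewrite mulmxBl opprD addrACA subrr add0r.
have uW : W \in unitmx.
  rewrite -row_free_unit; apply: inj_row_free => l lW.
  by apply/eqP; rewrite -(mulmx_free_eq0 _ fE) EW mulmxA lW mul0mx.
have -> : V = (`|\det W|%:E * lebesgue_tuple (@unit_simplex R n))%E.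
  rewrite /V EW trmx_mul -mulmxA [Q *m (_ *m _)]mulmxA QQ mul1mx.
  by rewrite det_mulmx det_tr -expr2 sqrtr_sqr.
pose b := - (row_of_tuple u0 *m invmx W).
have -> : flat_chart p Q @^-1` S = affine_map (invmx W) b @^-1` @unit_simplex R
  n.
  rewrite /S convex_hull_range_image -/E; apply/seteqP; split => t /=.
    case=> s Ds st; rewrite (_ : affine_map _ _ _ = s) //.
    apply: (can_inj (@row_of_tupleK R n)); rewrite tuple_of_rowK /b -mulmxBl.
    apply: (canLR (mulmxK uW)); apply/eqP; rewrite subr_eq addrC; apply/eqP.
    (* Multiplying by [Q^T] passes from points of the flat to chart coordinates. *)
    have := congr1 (mulmxr Q^T) st; rewrite /= -u0E !chartE EW.
    rewrite !mulmxDl -!mulmxA QQ !mulmx1 -addrA.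
    by move/addrI.
  move=> Dt; exists (affine_map (invmx W) b t) => //.
  rewrite -u0E !chartE tuple_of_rowK EW mulmxA mulmxDl mulmxKV // /b mulNmx
    mulmxKV //.
  by rewrite -addrA -mulmxDl [row_of_tuple u0 + _]addrC subrK.
have uW' : invmx W \in unitmx by rewrite unitmx_inv.
rewrite -(lebesgue_tuple_affine b uW' (@measurable_unit_simplex R n)).
rewrite muleA -EFinM det_inv -normrM divff ?normr1 ?mul1e //.
by rewrite -unitfE -unitmxE.
Qed.
End flat_simplices.

(** * Gradients of barycentric coordinates *)

Section gradients.
Context {R : realType} {m : nat}.
Implicit Type x : 'I_m.+2 -> 'rV[R]_m.+1.

Definition homogeneous_mx x : 'M[R]_m.+2 :=
  row_mx (const_mx 1 : 'cV_m.+2) (\matrix_i x i) : 'M[R]_(m.+2, 1 + m.+1).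

(** Column [i] of the inverse holds the coefficients of the [i]-th barycentric coordinate as an
    affine function: first the constant term, then the gradient. *)
Definition gradient x (i : 'I_m.+2) : 'rV[R]_m.+1 :=
  (col i (dsubmx (invmx (homogeneous_mx x) : 'M[R]_(1 + m.+1, m.+2))))^T.

Lemma homogeneous_mxE0 x i : homogeneous_mx x i ord0 = 1.
Proof.
have -> : ord0 = lshift m.+1 (0 : 'I_1) by exact/val_inj.
by rewrite [LHS](@row_mxEl _ _ 1 m.+1) mxE.
Qed.

Lemma homogeneous_mxES x i j : homogeneous_mx x i (lift ord0 j) = x i 0 j.
Proof.
have -> : lift ord0 j = rshift 1 j by exact/val_inj.
by rewrite [LHS](@row_mxEr _ _ 1 m.+1) mxE.
Qed.

Lemma gradientE x i j :
  gradient x i 0 j = invmx (homogeneous_mx x) (lift ord0 j) i.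
Proof. by rewrite !mxE; congr (invmx _ _ _); exact/val_inj. Qed.

(** A row [l] is sent by the matrix to the pair (sum of l_i, sum of l_i x_i), so its left kernel
    consists of the affine dependences. *)
Lemma affinely_independent_unitmx x :
  affinely_independent x <-> homogeneous_mx x \in unitmx.
Proof.
have mulX l : l *m homogeneous_mx x =
    row_mx (\sum_i l 0 i)%:M (\sum_i l 0 i *: x i) :> 'rV[R]_(1 + m.+1).
  rewrite [LHS](@mul_mx_row R 1 m.+2 1 m.+1); congr row_mx.
    by apply/rowP => j; rewrite ord1 !mxE eqxx; apply: eq_bigr => i _;
      rewrite mxE mulr1.
  by rewrite mulmx_sum_row; apply: eq_bigr => i _; rewrite rowK.
rewrite -row_free_unit; split=> [aff|fX l [i li] l0].
  apply: inj_row_free => l; rewrite mulX => lE.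
  have [/matrixP/(_ 0 0) l0 l1] :=
    @eq_row_mx R 1 1 m.+1 _ _ _ _ (etrans lE (esym (@row_mx0 _ 1 1 m.+1))).
  rewrite !mxE eqxx in l0; apply/rowP => i; rewrite [RHS]mxE; apply/eqP;
    apply: contraT => li.
  by have := aff (l 0) (ex_intro _ i li) l0; rewrite l1 eqxx.
apply/eqP => l1; have /eqP : (\row_i l i) *m homogeneous_mx x = 0.
  rewrite mulX (eq_bigr l) => [|k _]; last by rewrite mxE.
  rewrite (eq_bigr (fun k => l k *: x k)) => [|k _]; last by rewrite mxE.
  by rewrite l0 l1 raddf0 (@row_mx0 _ 1 1 m.+1).
by rewrite (mulmx_free_eq0 _ fX) => /eqP/rowP/(_ i); rewrite !mxE => /eqP;
  rewrite (negbTE li).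
Qed.

Section affinely_independent.
Variable x : 'I_m.+2 -> 'rV[R]_m.+1.
Hypothesis uX : homogeneous_mx x \in unitmx.

(** The product of the homogeneous matrix with its inverse evaluates the [i]-th barycentric
    coordinate at the vertices; the difference of two values cancels the constant term. *)
Lemma dot_gradient i j k :
  dot (gradient x i) (x j - x k) = (i == j)%:R - (i == k)%:R.
Proof.
pose h i := invmx (homogeneous_mx x) ord0 i.
suff E l : h i + dot (gradient x i) (x l) = (i == l)%:R.
  by rewrite -!E opprD addrACA subrr add0r dotBr.
have /matrixP/(_ l i) := mulmxV uX.
rewrite [X in X = _]mxE [1%:M _ _]mxE big_ord_recl eq_sym => <-.
rewrite homogeneous_mxE0 mul1r; congr (_ + _); rewrite dotC dotE.
by apply: eq_bigr => q _; rewrite homogeneous_mxES gradientE.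
Qed.

(** Barycentric coordinates sum to the constant 1: the inverse is applied to the all-ones first
    column of the matrix. *)
Lemma sum_gradient : \sum_i gradient x i = 0.
Proof.
apply/rowP => q; rewrite summxE [RHS]mxE.
have /matrixP/(_ (lift ord0 q) ord0) := mulVmx uX.
rewrite [X in X = _]mxE [1%:M _ _]mxE /= => sum0; rewrite -[RHS]sum0.
by apply: eq_bigr => i _; rewrite gradientE homogeneous_mxE0 mulr1.
Qed.

Lemma affinely_independent_inj : injective x.
Proof.
move=> j k jk; have := dot_gradient j j k.
rewrite jk subrr -[0 in LHS](scale0r (x k)) dotZr mul0r eqxx.
by case: eqP => // _ /esym/eqP; rewrite subr0 oner_eq0.
Qed.

End affinely_independent.

(** Subtract the first row from all others. *)
Lemma det_homogeneous_mx x : \det (homogeneous_mx x) = \det (edge_matrix x).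
Proof.
have -> : homogeneous_mx x = block_mx 1%:M 0 (const_mx 1) 1%:M *m
    block_mx 1%:M (x ord0) 0 (edge_matrix x) :> 'M[R]_(1 + m.+1).
  rewrite mulmx_block !mul1mx !mulmx1 !mulmx0 !mul0mx !addr0.
  apply/matrixP => i j.
  case: (unliftP ord0 j) => [q|] ->.
    rewrite homogeneous_mxES (_ : lift ord0 q = rshift 1 q); last exact/val_inj.
    case: (unliftP ord0 i) => [k|] ->.
      rewrite (_ : lift ord0 k = rshift 1 k); last exact/val_inj.
      rewrite block_mxEdr !mxE big_ord1 mxE mul1r addrC.
      rewrite (_ : rshift 1 k = lift ord0 k) ?subrK //; exact/val_inj.
    rewrite -[in RHS](_ : lshift m.+1 (0 : 'I_1) = ord0); last exact/val_inj.
    by rewrite block_mxEur; congr (x _ _ _); exact/val_inj.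
  rewrite homogeneous_mxE0 -[in RHS](_ : lshift m.+1 (0 : 'I_1) = ord0);
    last exact/val_inj.
  case: (splitP i) => k ik.
    rewrite (_ : i = lshift m.+1 k); last exact/val_inj.
    by rewrite block_mxEul mxE ord1.
  rewrite (_ : i = rshift 1 k); last exact/val_inj.
  by rewrite block_mxEdl mxE.
by rewrite det_mulmx (@det_lblock R 1 m.+1) (@det_ublock R 1 m.+1) !det1 !mul1r.
Qed.

Lemma det_homogeneous_mx_perm x (s : 'S_m.+2) :
  `|\det (homogeneous_mx (x \o s))| = `|\det (homogeneous_mx x)|.
Proof.
have -> : homogeneous_mx (x \o s) = row_perm s (homogeneous_mx x).
  apply/matrixP => i j; rewrite [RHS]mxE; case: (unliftP ord0 j) => [q|] ->.
    by rewrite !homogeneous_mxES.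
  by rewrite !homogeneous_mxE0.
by rewrite row_permE det_mulmx det_perm normrM normrX normrN1 expr1n mul1r.
Qed.

End gradients.

(* Multiply the matrix with rows [g], [E] by its own transpose and by that of
   the matrix with rows [f], [E]: both products are block triangular. *)
Lemma det_gram_facet {R : realType} m (f g : 'rV[R]_(1 + m))
    (E : 'M[R]_(m, 1 + m)) :
  row_free E -> dot g f = 1 -> g *m E^T = 0 ->
  \det (E *m E^T) = dot g g * \det (col_mx f E) ^+ 2.
Proof.
move=> fE gf gE.
have Eg : E *m g^T = 0 by rewrite -[E *m _]trmxK trmx_mul trmxK gE trmx0.
have detM : \det (col_mx g E) ^+ 2 = dot g g * \det (E *m E^T).
  rewrite expr2 -{2}det_tr -det_mulmx tr_col_mx mul_col_row gE det_lblock.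
  by rewrite [g *m _]mx11_scalar det_scalar1.
have detFM : \det (col_mx f E) * \det (col_mx g E) = \det (E *m E^T).
  rewrite -[X in _ * X]det_tr -det_mulmx tr_col_mx mul_col_row Eg det_ublock.
  by rewrite [f *m _]mx11_scalar det_scalar1 -/(dot f g) dotC gf mul1r.
(* If v E E^T = 0 then v E has norm zero, so v = 0 by row freeness; the Gram determinant can
   therefore be cancelled. *)
have d0 : \det (E *m E^T) != 0.
  rewrite -unitfE -unitmxE -row_free_unit; apply: inj_row_free => v.
  rewrite mulmxA => vE; apply/eqP; rewrite -(mulmx_free_eq0 _ fE) -dotrr_eq0.
  by rewrite /dot trmx_mul mulmxA vE mul0mx mxE.
apply: (mulfI d0); rewrite [RHS]mulrA [_ * dot g g]mulrC -detM -exprMn.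
by rewrite [_ * \det (col_mx f E)]mulrC detFM.
Qed.

(** * Facet volumes as multiples of gradient norms *)

Section facet_volume.
Context {R : realType} {m : nat}.

Lemma facet_volume_vectorE (c : R) (x : 'I_m.+2 -> 'rV[R]_m.+1) i :
  lebesgue_tuple (@unit_simplex R m) = c%:E ->
  affinely_independent x ->
  facet_volume_vector x 0 i =
  c * `|\det (homogeneous_mx x)| * Num.sqrt (dot (gradient x i) (gradient x i)).
Proof.
move=> cE /affinely_independent_unitmx uX.
(* Edge matrices are based at vertex 0. Moving [x i] to position 1 keeps a common base vertex for
   simplex and facet, and makes the edge [f] to [x i] the row above the edges [E] of the facet. *)
pose o : 'I_m.+2 := lift ord0 ord0.
pose s : 'S_m.+2 := tperm o i.
have so : s o = i by rewrite tpermL.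
pose y (k : 'I_m.+1) := x (s (lift o k)).
have facetE : facet x i = convex_hull (range y).
  congr convex_hull; apply/seteqP; split=> [_ [[k _ <-] xki]|_ [k _ <-]].
    have [j|kE] := unliftP o (s^-1%g k).
      by move=> kE; exists j => //; rewrite /y -kE permKV.
    by case: xki; rewrite /= -so -kE permKV.
  split; first by exists (s (lift o k)).
  (* The facet removes the point [x i] rather than the index [i], hence the appeal to
     injectivity. *)
  move=> /= /(affinely_independent_inj uX); rewrite -so => /perm_inj/eqP.
  by rewrite eq_sym (negbTE (neq_lift _ _)).
pose f : 'rV[R]_(1 + m) := x i - x (s ord0).
pose E : 'M[R]_(m, 1 + m) := edge_matrix y.
have y0 : y ord0 = x (s ord0) by congr (x (s _)); exact/val_inj.
have yS j : y (lift ord0 j) = x (s (lift ord0 (lift ord0 j))).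
  by congr (x (s _)); exact/val_inj.
have FE : edge_matrix (x \o s) = col_mx f E.
  apply/row_matrixP => k; rewrite rowK /=.
  case: (unliftP ord0 k) => [l|] ->.
    have -> : row (lift ord0 l) (col_mx f E) = row l E.
      by rewrite -(rowKd l f E); congr row; exact/val_inj.
    by rewrite rowK y0 yS.
  have -> : row ord0 (col_mx f E) = row 0 f.
    by rewrite -(rowKu 0 f E); congr row; exact/val_inj.
  by rewrite row_id /f -[in RHS]so.
have detF : `|\det (col_mx f E)| = `|\det (homogeneous_mx x)|.
  by rewrite -FE -det_homogeneous_mx det_homogeneous_mx_perm.
have fE : row_free E.
  apply: inj_row_free => l lE.
  have uF : row_free (col_mx f E).
    by rewrite row_free_unit unitmxE unitfE -normr_eq0 detF normr_eq0 -unitfE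
      -unitmxE.
  have : row_mx 0 l *m col_mx f E == 0 by rewrite mul_row_col mul0mx add0r lE.
  rewrite (mulmx_free_eq0 _ uF) -(@row_mx0 _ 1 1 m) => /eqP lE0.
  by have [] := @eq_row_mx R 1 1 m _ _ _ _ lE0.
set g := gradient x i.
have gf : dot g f = 1.
  by rewrite dot_gradient // eqxx -so (inj_eq perm_inj) subr0.
have gE : g *m E^T = 0.
  apply/rowP => j; rewrite [RHS]mxE.
  rewrite (_ : (g *m E^T) 0 j = dot g (row j E)); last first.
    by rewrite dotE mxE; apply: eq_bigr => k _;
      rewrite [E^T _ _]mxE [row j E 0 k]mxE.
  rewrite rowK y0 yS dot_gradient // -so !(inj_eq perm_inj).
  by rewrite subrr.
rewrite mxE facetE flat_volume_convex_hull // -/E cE /= (det_gram_facet fE gf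
  gE).
rewrite sqrtrM ?dotrr_ge0 // sqrtr_sqr detF mulrC [X in _ * X]mulrC mulrA //.
Qed.

End facet_volume.

(** * The strict polygon inequality for gradients *)

Section norm.
Context {R : rcfType} {d : nat}.
Implicit Types u v : 'rV[R]_d.

Definition enorm u : R := Num.sqrt (dot u u).

Lemma sqr_enorm u : enorm u ^+ 2 = dot u u.
Proof. by rewrite sqr_sqrtr // dotrr_ge0. Qed.

Lemma enorm_gt0 u : (0 < enorm u) = (u != 0).
Proof. by rewrite sqrtr_gt0 dotrr_gt0. Qed.

(** The squared norm of |u| v + |v| u is 2 |u| |v| (|u| |v| + u.v), and it is positive unless u and
    v point in opposite directions. *)
Lemma cauchy_schwarz_lt u v : u != 0 -> v != 0 ->
  enorm u *: v + enorm v *: u != 0 -> - dot u v < enorm u * enorm v.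
Proof.
rewrite -[u != 0]enorm_gt0 -[v != 0]enorm_gt0 => u0 v0; rewrite -dotrr_gt0.
rewrite dotDl !dotDr !dotZl !dotZr -!sqr_enorm [dot v u]dotC => w0.
have uv0 : 0 < enorm u * enorm v by exact: mulr_gt0.
rewrite -subr_gt0 opprK -(pmulr_rgt0 _ uv0) -(pmulr_rgt0 _ (ltr0n R 2)).
by move: w0; congr (is_true (0 < _)); ring.
Qed.

End norm.

Lemma exists_other n (j : 'I_n.+2) : exists k, k != j.
Proof.
by case: (unliftP ord0 j) => [q|] ->; [exists ord0|exists (lift ord0 ord0)].
Qed.

Lemma exists_third n (i j : 'I_n.+3) : exists k, (k != i) && (k != j).
Proof.
apply/existsP; apply: contraT; rewrite negb_exists => /forallP ij.
have sub : {subset enum 'I_n.+3 <= [:: i; j]}.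
  by move=> k _; have := ij k; rewrite negb_and !negbK !inE.
by have := uniq_leq_size (enum_uniq _) sub; rewrite size_enum_ord.
Qed.

Lemma gradient_neq0 {R : realType} n (x : 'I_n.+2 -> 'rV[R]_n.+1) j :
  homogeneous_mx x \in unitmx -> gradient x j != 0.
Proof.
move=> uX; have [k kj] := exists_other j.
apply: contraTneq (oner_neq0 R) => gj0; rewrite negbK.
have := dot_gradient uX j j k; rewrite gj0 /dot mul0mx mxE.
by rewrite eqxx eq_sym (negbTE kj) subr0 => /esym/eqP.
Qed.

(** As the gradients sum to zero, |g_i|^2 is the sum of the -g_i.g_j over the other j, and strict
    Cauchy-Schwarz bounds each term by |g_i| |g_j|. *)
Lemma enorm_gradient_lt {R : realType} n (x : 'I_n.+3 -> 'rV[R]_n.+2) i :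
  homogeneous_mx x \in unitmx ->
  enorm (gradient x i) < \sum_(j | j != i) enorm (gradient x j).
Proof.
move=> uX.
have g0 j := gradient_neq0 j uX.
have gi : 0 < enorm (gradient x i) by rewrite enorm_gt0.
rewrite -(ltr_pM2l gi) -expr2 sqr_enorm mulr_sumr.
have -> : dot (gradient x i) (gradient x i) =
    \sum_(j | j != i) - dot (gradient x i) (gradient x j).
  have /(congr1 (fun u => dot u (gradient x i))) := sum_gradient uX.
  rewrite dot_suml (bigD1 i) //= [RHS]/dot mul0mx mxE => /eqP.
  rewrite addr_eq0 => /eqP ->; rewrite -sumrN.
  by apply: eq_bigr => j _; rewrite dotC.
apply: ltr_sum.
  have [k /andP[ki _]] := exists_third i i.
  by apply/hasP; exists k; rewrite ?mem_index_enum.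
move=> j ji; apply: cauchy_schwarz_lt => //.
(* Pairing with x_j - x_k for a third vertex x_k kills g_i and gives 1 on g_j; a vanishing
   combination would thus force |g_i| = 0. *)
have [k /andP[kj ki]] := exists_third j i.
apply: contraTneq gi => w0; rewrite -leNgt.
suff -> : enorm (gradient x i) = 0 by [].
have : dot (enorm (gradient x i) *: gradient x j + enorm (gradient x j) *:
  gradient x i) (x j - x k) = 0.
  by rewrite w0 /dot mul0mx mxE.
rewrite dotDl !dotZl !dot_gradient // eqxx !(eq_sym _ k) (negbTE kj) (negbTE
  ki).
by rewrite (eq_sym i) (negbTE ji) !subr0 mulr0 mulr1 addr0.
Qed.

(** The sum depends on [s] only through [s ord_max], and a transposition brings any index there. *)
Lemma polygon_inequalities_perm (R : numDomainType) d (a : 'I_d.+1 -> R) :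
  (forall s : 'S_d.+1,
     a (s ord_max) < \sum_(i < d) a (s (widen_ord (leqnSn d) i))) <->
  (forall i, a i < \sum_(j | j != i) a j).
Proof.
have E (s : 'S_d.+1) : \sum_(i < d) a (s (widen_ord (leqnSn d) i)) =
    \sum_(j | j != s ord_max) a j.
  apply: (addIr (a (s ord_max))); transitivity (\sum_j a j).
    by rewrite (reindex_inj (@perm_inj _ s)) big_ord_recr.
  by rewrite (bigD1 (s ord_max)) //= addrC.
split=> aE => [i|s]; last by rewrite E.
by have := aE (tperm i ord_max); rewrite E tpermR.
Qed.

(** * Closed polygons with prescribed side lengths *)

Section vectors_with_prescribed_norms.
Context {R : realType}.

(** Spanning is encoded as triviality of the orthogonal complement. *)
Definition closed_spanning_family k n (g : 'I_k -> 'rV[R]_n) : Prop :=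
  \sum_i g i = 0 /\ forall u, (forall i, dot (g i) u = 0) -> u = 0.

(* The vector g_0 is replaced by two vectors whose sum is g_0 and whose
   components along a new dimension are opposite and nonzero. *)
Lemma closed_spanning_family_split k n (g : 'I_k.+1 -> 'rV[R]_n) (b a0 a1 : R) :
  closed_spanning_family g -> dot (g ord0) (g ord0) = b ^+ 2 -> 0 < b ->
  0 < a0 -> 0 < a1 -> `|a0 - a1| < b -> b < a0 + a1 ->
  exists f : 'I_k.+2 -> 'rV[R]_n.+1, [/\ closed_spanning_family f,
    dot (f ord0) (f ord0) = a0 ^+ 2,
    dot (f (lift ord0 ord0)) (f (lift ord0 ord0)) = a1 ^+ 2 &
    forall j, dot (f (lift ord0 (lift ord0 j))) (f (lift ord0 (lift ord0 j))) =
              dot (g (lift ord0 j)) (g (lift ord0 j))].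
Proof.
move=> [g_sum g_span] gb b0 a00 a10 ab ba.
(* In the triangle with sides b, a0, a1, the side a0 projects onto the side b with length s b, and h
   is the squared height over b. *)
pose s := (b ^+ 2 + a0 ^+ 2 - a1 ^+ 2) / (2 * b ^+ 2).
pose h := a0 ^+ 2 - (s * b) ^+ 2.
have bn0 : b != 0 by rewrite gt_eqF.
have h0 : 0 < h.
  move: ab; rewrite ltr_norml => /andP[ab1 ab2].
  (* Heron's formula: every factor is positive by a strict triangle inequality. *)
  have -> : h = ((a0 + a1 - b) * (a0 + a1 + b)) * ((b - a0 + a1) * (b + a0 -
    a1)) / (4 * b ^+ 2).
    by rewrite /h /s; field.
  rewrite divr_gt0 ?mulr_gt0 ?exprn_gt0 //; lra.
pose t := Num.sqrt h.
have tt : t ^+ 2 = h by rewrite sqr_sqrtr // ltW.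
have t0 : t != 0 by rewrite gt_eqF // sqrtr_gt0.
pose vec (r : R) (u : 'rV[R]_n) : 'rV[R]_n.+1 := row_mx r%:M u : 'rV_(1 + n).
have dot_vec r u r' u' : dot (vec r u) (vec r' u') = r * r' + dot u u'.
  rewrite /dot /vec (@tr_row_mx R 1 1 n) (@mul_row_col R 1 1 n 1) mxE.
  by rewrite tr_scalar_mx -scalar_mxM mxE eqxx mulr1n.
pose f (i : 'I_k.+2) := match unlift ord0 i with
  | None => vec t (s *: g ord0)
  | Some j => match unlift ord0 j with
              | None => vec (- t) ((1 - s) *: g ord0)
              | Some q => vec 0 (g (lift ord0 q))
              end
  end.
have f0 : f ord0 = vec t (s *: g ord0) by rewrite /f unlift_none.
have f1 : f (lift ord0 ord0) = vec (- t) ((1 - s) *: g ord0).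
  by rewrite /f liftK unlift_none.
have f2 j : f (lift ord0 (lift ord0 j)) = vec 0 (g (lift ord0 j)).
  by rewrite /f !liftK.
have vecD r u r' u' : vec r u + vec r' u' = vec (r + r') (u + u').
  by rewrite /vec (@add_row_mx R 1 1 n) -raddfD.
exists f; split.
- split.
    rewrite !big_ord_recl f0 f1 (eq_bigr _ (fun j _ => f2 j)).
    have -> : \sum_i vec 0 (g (lift ord0 i)) = vec 0 (\sum_i g (lift ord0 i)).
      elim/big_rec2: _ => [|i u v _ ->]; last by rewrite vecD addr0.
      by rewrite /vec raddf0 (@row_mx0 _ 1 1 n).
    rewrite addrA !vecD subrr add0r -scalerDl [s + _]addrC subrK scale1r.
    have := g_sum; rewrite big_ord_recl => ->.
    by rewrite /vec raddf0 (@row_mx0 _ 1 1 n).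
  move=> u fu.
  have uE : u = vec (u 0 ord0) (rsubmx (u : 'rV_(1 + n))).
    rewrite /vec -[LHS](@hsubmxK R 1 1 n); congr (@row_mx R 1 1 n _ _).
    apply/rowP => j; rewrite ord1 !mxE eqxx mulr1n; congr (u 0 _);
      exact/val_inj.
  set u0 := u 0 ord0 in uE; set u' := rsubmx _ in uE.
  have fv i : dot (f i) (vec u0 u') = 0 by rewrite -uE.
  have := fv ord0; rewrite f0 dot_vec => e0.
  have := fv (lift ord0 ord0); rewrite f1 dot_vec => e1.
  have u'0 : u' = 0.
    apply: g_span => i; case: (unliftP ord0 i) => [j|] ->.
      by have := fv (lift ord0 (lift ord0 j)); rewrite f2 dot_vec mul0r add0r.
    (* Adding the two equations cancels the new coordinate and leaves orthogonality to [g ord0]. *)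
    move: e0 e1; rewrite !dotZl => e0 e1; rewrite -[RHS]addr0 -{1}e0 -e1; ring.
  move: e0; rewrite u'0 dotC /dot mul0mx mxE addr0 => /eqP.
  rewrite mulf_eq0 (negbTE t0) /= => /eqP u00.
  by rewrite uE u'0 u00 /vec raddf0 (@row_mx0 _ 1 1 n).
- rewrite f0 dot_vec dotZl dotZr gb -expr2 tt /h; ring.
- rewrite f1 dot_vec dotZl dotZr gb mulrNN -expr2 tt /h /s; field.
  exact: bn0.
- by move=> j; rewrite f2 dot_vec mul0r add0r.
Qed.

Lemma ltr_sum_pos n (a : 'I_n.+2 -> R) j : (forall i, 0 < a i) ->
  a j < \sum_i a i.
Proof.
move=> a0; rewrite (bigD1 j) //= ltrDl.
have [k kj] := exists_other j.
by rewrite (bigD1 k) //= ltr_wpDr // sumr_ge0 // => i _; exact: ltW.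
Qed.

(** Induction on the dimension: replace the first two lengths by one length [b] for which the
    shorter list still satisfies the polygon inequalities, then split the side [b]. *)
Lemma closed_spanning_family_exists n (a : 'I_n.+3 -> R) :
  (forall i, 0 < a i) -> (forall i, a i *+ 2 < \sum_j a j) ->
  exists2 g : 'I_n.+3 -> 'rV[R]_n.+2, closed_spanning_family g &
    forall i, dot (g i) (g i) = a i ^+ 2.
Proof.
pose o : forall k, 'I_k.+2 := fun k => lift ord0 ord0.
elim: n a => [|n IH] a a0 ha.
  (* The triangle arises from the segment of length [b] run forth and back on a line, by splitting
     its forward copy. *)
  pose b := a (lift ord0 (lift ord0 ord0)).
  pose g (i : 'I_2) : 'rV[R]_1 := if i == ord0 then b%:M else - b%:M.
  have dotg r r' : dot (r%:M : 'rV[R]_1) r'%:M = r * r'.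
    by rewrite /dot tr_scalar_mx -scalar_mxM mxE eqxx mulr1n.
  have gC : closed_spanning_family g.
    split=> [|u /(_ ord0)];
      first by rewrite !big_ord_recl big_ord0 /g /= addr0 subrr.
    rewrite /g eqxx [u]mx11_scalar dotg => /eqP; rewrite mulf_eq0.
    by rewrite gt_eqF ?a0 //= => /eqP ->; rewrite raddf0.
  have := ha ord0; have := ha (o _); have := ha (lift ord0 (lift ord0 ord0)).
  rewrite !big_ord_recl !big_ord0 -!/(o _) -/b !addr0 => h2 h1 h0.
  have := @closed_spanning_family_split _ _ g b (a ord0) (a (o _)) gC _ _ _ _ _
    _.
  case=> //; rewrite ?a0 //.
  - by rewrite /g eqxx dotg.
  - rewrite ltr_norml; apply/andP; split; lra.
  - lra.
  move=> f [fC f0 f1 f2]; exists f => // i.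
  case: (unliftP ord0 i) => [j|] -> //; case: (unliftP ord0 j) => [q|] -> //.
  by rewrite f2 ord1 /g /= dotNl dotC dotNl opprK dotg -expr2.
pose S := \sum_(j < n.+2) a (lift ord0 (lift ord0 j)).
(* Bounds for [b]: it has to form a triangle with the first two lengths and satisfy the polygon
   inequalities with the remaining ones, whose sum is [S]. *)
pose L := \big[Num.max/`|a ord0 - a (o _)|]_(j < n.+2)
  (a (lift ord0 (lift ord0 j)) *+ 2 - S).
pose U := Num.min (a ord0 + a (o _)) S.
have sumE : \sum_j a j = a ord0 + (a (o _) + S).
  by rewrite big_ord_recl; congr (_ + _); rewrite big_ord_recl.
have h0 := ha ord0; have h1 := ha (o _); rewrite sumE in h0 h1.
have p0 := a0 ord0; have p1 := a0 (o _).
have LU : L < U.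
  apply: bigmax_lt => [|j _]; rewrite lt_min; apply/andP; split.
  - rewrite ltr_norml; apply/andP; split; lra.
  - rewrite ltr_norml; apply/andP; split; lra.
  - by have := ha (lift ord0 (lift ord0 j)); rewrite sumE; lra.
  (* One remaining length is less than [S] because at least two positive lengths remain. *)
  - have := @ltr_sum_pos n (fun j => a (lift ord0 (lift ord0 j))) j (fun=> a0
    _).
    by rewrite -/S; lra.
pose b := (L + U) / 2.
have bL : L < b by rewrite /b; lra.
have : b < U by rewrite /b; lra.
rewrite lt_min => /andP[bU bS].
have b1 : `|a ord0 - a (o _)| < b by apply: le_lt_trans bL; exact: bigmax_ge_id.
have b2 j : a (lift ord0 (lift ord0 j)) *+ 2 - S < b.
  apply: le_lt_trans bL;
    exact: (le_bigmax _ (fun j => a (lift ord0 (lift ord0 j)) *+ 2 - S)).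
have b0 : 0 < b by apply: le_lt_trans b1; exact: normr_ge0.
pose a' (i : 'I_n.+3) := if unlift ord0 i is Some j then a (lift ord0 (lift
  ord0 j)) else b.
have a'0 : a' ord0 = b by rewrite /a' unlift_none.
have a'S j : a' (lift ord0 j) = a (lift ord0 (lift ord0 j)) by rewrite /a'
  liftK.
have sumE' : \sum_j a' j = b + S.
  by rewrite big_ord_recl a'0; congr (_ + _); apply: eq_bigr => j _;
    rewrite a'S.
have [||g gC gE] := IH a'.
- by move=> i; rewrite /a'; case: unliftP.
- move=> i; rewrite sumE'; case: (unliftP ord0 i) => [j|] ->;
  last by rewrite a'0; lra.
  by rewrite a'S; have := b2 j; lra.
have gb : dot (g ord0) (g ord0) = b ^+ 2 by rewrite gE a'0.
have [f [fC f0 f1 f2]] := closed_spanning_family_split gC gb b0 p0 p1 b1 bU.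
exists f => // i.
case: (unliftP ord0 i) => [j|] -> //; case: (unliftP ord0 j) => [q|] -> //.
by rewrite f2 gE a'S.
Qed.

End vectors_with_prescribed_norms.

(** * Simplices with prescribed gradients *)

Section simplex_with_prescribed_gradients.
Context {R : realType} {m : nat}.
Implicit Type g : 'I_m.+2 -> 'rV[R]_m.+1.

(* The candidate inverse of [homogeneous_mx]: its first row only has to have
   sum 1. *)
Definition dual_mx g : 'M[R]_m.+2 :=
  col_mx (const_mx m.+2%:R^-1 : 'rV_m.+2) (\matrix_i g i)^T
    :> 'M[R]_(1 + m.+1, m.+2).

Lemma det_dual_mxZ g (k : R) :
  \det (dual_mx (fun i => k *: g i)) = k ^+ m.+1 * \det (dual_mx g).
Proof.
have -> : dual_mx (fun i => k *: g i) =
    block_mx 1%:M 0 0 k%:M *m (dual_mx g : 'M[R]_(1 + m.+1, m.+2)).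
  rewrite [RHS](@mul_block_col R 1 m.+1 1 m.+1 m.+2) mul1mx !mul0mx addr0 add0r.
  congr (@col_mx R 1 m.+1 m.+2 _ _).
  by rewrite mul_scalar_mx; apply/matrixP => i j; rewrite !mxE.
by rewrite [LHS]det_mulmx (@det_ublock R 1 m.+1) det1 mul1r det_scalar.
Qed.

(** This makes the first column of the inverse all ones, as in a homogeneous matrix. *)
Lemma dual_mx_ones g : \sum_i g i = 0 ->
  dual_mx g *m const_mx 1 = col_mx 1%:M 0 :> 'M[R]_(1 + m.+1, 1).
Proof.
move=> g0; rewrite [LHS](@mul_col_mx R 1 m.+1 m.+2 1).
congr (@col_mx R 1 m.+1 1 _ _); apply/matrixP => i j; rewrite !mxE.
  rewrite !ord1 eqxx (eq_bigr (fun=> m.+2%:R^-1)) => [|k _];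
    last by rewrite !mxE mulr1.
  by rewrite sumr_const card_ord -[LHS]mulr_natl divff // pnatr_eq0.
have /rowP/(_ i) := g0; rewrite summxE [X in _ = X]mxE => gi; rewrite -[RHS]gi.
by apply: eq_bigr => k _; rewrite !mxE mulr1.
Qed.

(** Let (r, u) be in the left kernel. Multiplying by the all-ones column gives r = 0; then u is
    orthogonal to every g_i and vanishes by spanning. *)
Lemma dual_mx_unit g : closed_spanning_family g -> dual_mx g \in unitmx.
Proof.
case=> g0 g_span; rewrite -row_free_unit; apply: inj_row_free => v.
rewrite -[v](@hsubmxK R 1 1 m.+1); set r := lsubmx _; set u := rsubmx _ => vY.
have r0 : r = 0.
  have := congr1 (mulmxr (const_mx 1 : 'cV_m.+2)) vY.
  rewrite /= -mulmxA dual_mx_ones // mul0mx (@mul_row_col R 1 1 m.+1 1).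
  by rewrite mulmx1 mulmx0 addr0.
move: vY; rewrite [X in X = _ -> _](@mul_row_col R 1 1 m.+1 m.+2) r0 mul0mx
  add0r => uG.
suff -> : u = 0 by exact: (@row_mx0 R 1 1 m.+1).
apply: g_span => i; have /rowP/(_ i) := uG; rewrite [X in _ = X]mxE => ui;
  rewrite -[RHS]ui.
by rewrite dotC dotE mxE; apply: eq_bigr => j _; rewrite !mxE.
Qed.

(** The inverse of [dual_mx g] has first column all ones, so its other columns are the coordinates
    of the vertices sought. *)
Lemma exists_gradient g : closed_spanning_family g ->
  exists x, [/\ homogeneous_mx x \in unitmx, gradient x = g &
    \det (homogeneous_mx x) = (\det (dual_mx g))^-1].
Proof.
move=> gC; have uY := dual_mx_unit gC.
pose x i := row i (rsubmx (invmx (dual_mx g) : 'M[R]_(m.+2, 1 + m.+1))).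
have xE : homogeneous_mx x = invmx (dual_mx g).
  rewrite -[RHS](@hsubmxK R m.+2 1 m.+1); congr (@row_mx R m.+2 1 m.+1 _ _);
    last first.
    by apply/row_matrixP => i; rewrite rowK.
  have := congr1 (mulmx (invmx (dual_mx g))) (dual_mx_ones gC.1).
  rewrite mulKmx // -{1}[invmx (dual_mx g)](@hsubmxK R m.+2 1 m.+1).
  by rewrite (@mul_row_col R m.+2 1 m.+1 1) mulmx1 mulmx0 addr0.
exists x; split; rewrite ?xE ?unitmx_inv ?det_inv //.
apply/funext => i; apply/rowP => j; rewrite gradientE xE invmxK.
rewrite (_ : lift ord0 j = rshift 1 j); last exact/val_inj.
by rewrite [LHS](@col_mxEd R 1 m.+1 m.+2) !mxE.
Qed.

End simplex_with_prescribed_gradients.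

(** * The image of the facet volume map *)

Unset Implicit Arguments.

Theorem theorem1p1 (R : realType) (d : nat) (hd : (2 <= d)%N) :
  @facet_volume_vector R d @` [set x | affinely_independent x] =
  [set a : 'rV[R]_d.+1 |
    (forall i : 'I_d.+1, 0 < a 0 i) /\
    (forall s : 'S_d.+1,
      a 0 (s ord_max) < \sum_(i < d) a 0 (s (widen_ord (leqnSn d) i)))].
Proof.
case: d hd => [|[|n]] // _.
have [c c0 cE] := @unit_simplex_volume R n.+1.
apply/seteqP; split=> [_ [x xA <-]|a /= [a0 /polygon_inequalities_perm ha]].
  have uX := (affinely_independent_unitmx x).1 xA.
  have K0 : 0 < c * `|\det (homogeneous_mx x)|.
    by rewrite mulr_gt0 // normr_gt0 -unitfE -unitmxE.
  have vE i : facet_volume_vector x 0 i =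
      c * `|\det (homogeneous_mx x)| * enorm (gradient x i).
    exact: facet_volume_vectorE.
  have lt i : facet_volume_vector x 0 i < \sum_(j | j != i) facet_volume_vector
    x 0 j.
    rewrite (eq_bigr _ (fun j _ => vE j)) vE -mulr_sumr ltr_pM2l //.
    exact: enorm_gradient_lt.
  split; last exact/polygon_inequalities_perm.
  by move=> i; rewrite vE mulr_gt0 // enorm_gt0 gradient_neq0.
have [|g gC gE] := @closed_spanning_family_exists R n (a 0) a0.
  by move=> i; rewrite (bigD1 i) //= mulr2n ltrD2l.
have D0 : 0 < `|\det (dual_mx g)|.
  by rewrite normr_gt0 -unitfE -unitmxE dual_mx_unit.
(* Write D for |det (dual_mx g)|. With gradients k g_i the facet volumes are c / (k^(n+2) D) times k
   a_i, which equals a_i exactly when k^(n+1) = c / D. *)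
pose r := c / `|\det (dual_mx g)|.
have r0 : 0 < r by exact: divr_gt0.
pose k := r `^ n.+1%:R^-1.
have k0 : 0 < k by exact: powR_gt0.
have kE : k ^+ n.+1 = r.
  by rewrite -powR_mulrn ?ltW // /k -powRrM mulVf ?pnatr_eq0 // powRr1 // ltW.
have kC : closed_spanning_family (fun i => k *: g i).
  case: gC => gs gsp; split=> [|u ku]; first by rewrite -scaler_sumr gs scaler0.
  apply: gsp => i; have /eqP := ku i.
  by rewrite dotZl mulf_eq0 gt_eqF //= => /eqP.
have [x [uX xg detX]] := exists_gradient kC.
have xA := (affinely_independent_unitmx x).2 uX.
exists x => //; apply/rowP => i.
rewrite (facet_volume_vectorE i cE xA) xg dotZl dotZr gE detX det_dual_mxZ.
have -> : k * (k * a 0 i ^+ 2) = (k * a 0 i) ^+ 2 by ring.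
rewrite sqrtr_sqr [`|k * _|]gtr0_norm ?mulr_gt0 //.
rewrite normfV normrM normrX (gtr0_norm k0) exprS kE /r.
have := D0; set D := `|_| => D0'.
field.
by rewrite !gt_eqF.
Qed.
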